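(* Let $k\ge 4$ be an integer. Every graph that does not contain the $k$-vertex wheel graph as a minor has treewidth at most $$2k+18\left\lceil\frac{1+\sqrt{2k-1}}{4}\right\rceil-10.$$
   Context: Graphs are finite and simple. The $k$-vertex wheel graph is obtained from a cycle of length $k-1$ by adding one new vertex adjacent to all vertices of the cycle. *)

(* Defs.v *)
From HB Require Import structures.
From mathcomp Require Import all_boot all_order all_algebra.
From mathcomp Require Import boolp reals.

Set Implicit Arguments.
Unset Strict Implicit.
Unset Printing Implicit Defensive.

Record sgraph := SGraph {
  vertex :> finType;
  edge : rel vertex;
  edge_sym : symmetric edge;
  edge_irrefl : irreflexive edge }.

Definition connected_set (G : sgraph) (A : {set G}) : Prop :=
  A != set0 /\
  {in A &, forall x y, connect [rel u v in A | edge u v] x y}.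

(* A duplicate-free cyclic sequence of length at least 3 is a cycle of the
   graph; the shorter ones are single vertices and edges. *)
Definition acyclic (G : sgraph) : Prop :=
  forall c : seq G, ucycle (@edge G) c -> size c < 3.

Definition is_tree (G : sgraph) : Prop :=
  connected_set [set: G] /\ acyclic G.

(* [H] is a minor of [G]: there are pairwise disjoint connected branch sets
   [phi x] in [G] whose contraction yields a supergraph of [H]. *)
Definition minor (H G : sgraph) : Prop :=
  exists phi : H -> {set G},
    [/\ forall x, connected_set (phi x),
        forall x y, x != y -> [disjoint phi x & phi y]
      & forall x y, edge x y ->
          exists u v, [/\ u \in phi x, v \in phi y & edge u v]].

Section Cycle.
Variable n : nat.

(* [ordS] is the cyclic successor on ['I_n]; the disequality only matters for
   n = 1, where it removes the loop. *)
Definition cycle_edge : rel 'I_n :=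
  [rel i j | (i != j) && ((j == ordS i) || (i == ordS j))].

Lemma cycle_edge_sym : symmetric cycle_edge.
Proof. by move=> i j; rewrite /cycle_edge /= eq_sym orbC. Qed.

Lemma cycle_edge_irrefl : irreflexive cycle_edge.
Proof. by move=> i; rewrite /cycle_edge /= eqxx. Qed.

Definition cycle_graph : sgraph := SGraph cycle_edge_sym cycle_edge_irrefl.

End Cycle.

Section Apex.
Variable G : sgraph.

Definition apex_edge : rel (option G) := fun x y =>
  match x, y with
  | Some u, Some v => edge u v
  | None, None => false
  | _, _ => true
  end.

Lemma apex_edge_sym : symmetric apex_edge.
Proof. by move=> [u|] [v|] //=; rewrite edge_sym. Qed.

Lemma apex_edge_irrefl : irreflexive apex_edge.
Proof. by move=> [u|] //=; rewrite edge_irrefl. Qed.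

Definition add_apex : sgraph := SGraph apex_edge_sym apex_edge_irrefl.

End Apex.

Definition wheel (k : nat) : sgraph := add_apex (cycle_graph k.-1).

(* The last field says that every vertex lies in some bag and that the nodes
   whose bags contain it induce a subtree of [T]. *)
Definition tree_decomposition (G T : sgraph) (bag : T -> {set G}) : Prop :=
  [/\ is_tree T,
      forall x y : G, edge x y -> exists t, (x \in bag t) && (y \in bag t)
    & forall x : G, connected_set [set t | x \in bag t]].

(* Predecessor is truncated: the graph with no vertex gets width 0. *)
Definition width (G T : sgraph) (bag : T -> {set G}) : nat :=
  (\max_(t : T) #|bag t|).-1.

Definition has_decomposition_of_width (G : sgraph) (w : nat) : Prop :=
  exists (T : sgraph) (bag : T -> {set G}),
    tree_decomposition bag /\ width bag = w.

Definition unit_graph : sgraph :=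
  @SGraph unit (fun _ _ => false) (fun _ _ => erefl) (fun _ => erefl).

Lemma ex_width (G : sgraph) : exists w, `[< has_decomposition_of_width G w >].
Proof.
have conn1 (A : {set unit_graph}) : tt \in A -> connected_set A.
  move=> ttA; split; first by apply/set0Pn; exists tt.
  by move=> [] [] _ _; exact: connect0.
exists (width (fun _ : unit_graph => [set: G])); apply/asboolP.
exists unit_graph, (fun _ => [set: G]); split=> //; split.
- split; first exact: conn1.
  by move=> [|[] [|[] c]] // /andP[].
- by move=> x y _; exists tt; rewrite !inE.
- by move=> x; apply: conn1; rewrite !inE.
Qed.

Definition treewidth (G : sgraph) : nat := ex_minn (ex_width G).

(* Main.v *)
Require Import Defs.
From HB Require Import structures.
From mathcomp Require Import all_boot all_order all_algebra.
From mathcomp Require Import boolp reals.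
From mathcomp Require Import zify.

Set Implicit Arguments.
Unset Strict Implicit.
Unset Printing Implicit Defensive.

(** A graph without the [k]-vertex wheel as a minor has treewidth at most
    [2k - 4] ([treewidth_no_wheel]), which is below the stated bound because the
    ceiling in it is at least 1.

    A bramble is a family of connected sets any two of which intersect or are
    joined by an edge.  Suppose that the treewidth is at least [2k - 3].  By the
    Seymour-Thomas duality ([treewidth_bramble]) there is a bramble such that
    every set of [2k - 3] vertices misses one of its members.

    A path is grown greedily into the component that still contains unmet
    members of the bramble, until it meets all of them ([growing_path]).  As in
    a depth-first search, this component [D] has all its neighbours on the
    path, and it contains a member [b].  Let [A] be an initial part of the path
    just long enough for the members that it meets not to be hit by [k - 2]
    vertices, so that [k - 1] suffice; let [S] be a final part as long as
    possible such that [k - 2] vertices hit the members that it meets.  Some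
    member [b'] escapes these [2k - 3] vertices, so it meets the path strictly
    between [A] and [S] only.  As [b'] touches [b], there is an edge between
    such a vertex of the path and [D].  It closes a cycle [c] that contains [S]
    and the vertex before it, and that avoids [A].

    Let [H] be the component of [A] in the complement of [c].  Its neighbourhood
    lies on [c] and separates [A] from [c].  It has at least [k - 1] vertices:
    fewer would miss a member that meets [A] and a member that meets [c], and
    these two members form a connected set going from [H] to [c].  Contracting
    [H] to a hub and cutting [c] into [k - 1] arcs, each with a neighbour of
    [H], gives the wheel ([wheel_of_marked_cycle]).

    The duality is proved by Mazoit's method.  A partial decomposition covers a
    vertex set [U] by small bags so that the neighbourhood of each component
    of the complement of [U] fits in a bag.  Without a full decomposition of
    small width, the connected sets with small neighbourhood form a family that
    is closed upwards and contains a component left by each partial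
    decomposition.  A minimal such family is a bramble.  Otherwise two minimal
    members [C] and [D] do not touch.  By minimality, some partial decomposition
    leaves [C] as its only component in the family, and another one leaves [D].
    They are cut along a smallest set [S] separating [C] from [D] and glued
    there; the result leaves no member of the family.  Cutting does not enlarge
    bags because [S] is linked by disjoint connected sets to the neighbourhoods
    of [C] and of [D], which is Menger's theorem ([linkage]). *)

(** * Connected sets and components *)

Lemma connect_closed (T : finType) (e : rel T) (P : T -> Prop) x y :
  P x -> (forall u v, P u -> e u v -> P v) -> connect e x y -> P y.
Proof.
move=> Px Pe /connectP[p pth ->].
elim: p x Px pth => //= z p IHp x Px /andP[exz pth].
exact: IHp (Pe _ _ Px exz) pth.
Qed.

Lemma connect_proj (T T' : finType) (f : T -> T') (e : rel T) (e' : rel T') x y :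
    (forall u v, e u v -> f u = f v \/ e' (f u) (f v)) ->
  connect e x y -> connect e' (f x) (f y).
Proof.
move=> fe; apply: (connect_closed (P := fun y => connect e' (f x) (f y))) => //.
move=> u v fxu /fe [<- //|e'uv]; exact: connect_trans fxu (connect1 e'uv).
Qed.

Lemma disjointP (T : finType) (A B : {pred T}) :
  reflect (forall x, x \in A -> x \notin B) [disjoint A & B].
Proof.
rewrite disjoint_subset; apply: (iffP subsetP) => AB x xA.
  by have := AB x xA; rewrite inE.
by rewrite inE; exact: AB.
Qed.

Arguments disjointP {T A B}.

Section Connectivity.
Variable G : sgraph.
Implicit Types (A B C D E K U W X Y : {set G}) (u v w x y : G).

Lemma connected_ind A (P : G -> Prop) x y :
    connected_set A -> x \in A -> P x ->
    (forall u v, u \in A -> v \in A -> edge u v -> P u -> P v) ->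
  y \in A -> P y.
Proof.
move=> [_ cA] xA Px step yA.
apply: (connect_closed Px _ (cA x y xA yA)) => u v Pu /= /andP[/andP[uA vA] uv].
exact: (step u v).
Qed.

(** Connectedness is shown by closure: this spares the handling of paths. *)
Lemma connectedI x A :
    x \in A ->
    (forall K, x \in K ->
       (forall u v, u \in A -> v \in A -> edge u v -> u \in K -> v \in K) ->
       {subset A <= K}) ->
  connected_set A.
Proof.
move=> xA cl; split; first by apply/set0Pn; exists x.
have sym : connect_sym [rel u v in A | edge u v].
  by apply: sym_connect_sym => u v /=; rewrite edge_sym [(u \in A) && _]andbC.
have reach y : y \in A -> connect [rel u v in A | edge u v] x y.
  move=> yA.
  suff : y \in [set y | connect [rel u v in A | edge u v] x y] by rewrite inE.
  apply: cl (yA); first by rewrite inE.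
  move=> u v uA vA uv; rewrite !inE => xu.
  by apply: connect_trans xu (connect1 _); rewrite /= uA vA.
move=> y z yA zA; apply: connect_trans (reach z zA).
by rewrite sym; exact: reach.
Qed.

Lemma connected1 x : connected_set [set x].
Proof.
apply: (@connectedI x); first exact: set11.
by move=> K xK _ y /set1P->.
Qed.

Definition touch A B := exists u v, [/\ u \in A, v \in B & (u == v) || edge u v].

Lemma touchS A A' B B' : A \subset A' -> B \subset B' -> touch A B -> touch A' B'.
Proof.
move=> /subsetP sA /subsetP sB [u [v [uA vB uv]]].
by exists u, v; split; [exact: sA | exact: sB |].
Qed.

Lemma connectedU A B :
  connected_set A -> connected_set B -> touch A B -> connected_set (A :|: B).
Proof.
move=> cA cB [u [v [uA vB uv]]].
apply: (@connectedI u); first by rewrite inE uA.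
move=> K uK cl.
have AK y : y \in A -> y \in K.
  apply: (connected_ind (P := fun y => y \in K) cA uA uK) => a b aA bA.
  by apply: cl; rewrite inE ?aA ?bA.
have vK : v \in K.
  case/orP: uv => [/eqP<- // | uv].
  by apply: (cl u v) => //; rewrite inE ?uA ?vB ?orbT.
have BK y : y \in B -> y \in K.
  apply: (connected_ind (P := fun y => y \in K) cB vB vK) => a b aA bA.
  by apply: cl; rewrite inE ?aA ?bA ?orbT.
by move=> y; rewrite inE => /orP[/AK|/BK].
Qed.

Definition nbhd A := [set v | (v \notin A) && [exists u in A, edge u v]].

Lemma nbhdP A v :
  reflect (v \notin A /\ exists2 u, u \in A & edge u v) (v \in nbhd A).
Proof.
rewrite inE; apply: (iffP andP) => -[vA].
  by move=> /exists_inP.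
by move=> ?; split=> //; apply/exists_inP.
Qed.

Arguments nbhdP {A v}.

Lemma connected_exit A Y x y :
    connected_set Y -> x \in Y -> x \in A -> y \in Y -> y \notin A ->
  exists2 z, z \in Y & z \in nbhd A.
Proof.
move=> cY xY xA yY yA; apply: contrapT => none.
case/negP: yA; apply: (connected_ind (P := fun y => y \in A) cY xY xA) yY.
move=> u v uY vY uv uA; case: (boolP (v \in A)) => // vA.
by case: none; exists v => //; apply/nbhdP; split=> //; exists u.
Qed.

Definition is_component U E :=
  [/\ connected_set E, [disjoint E & U] & nbhd E \subset U].

Definition component U x :=
  [set y | connect [rel u v in ~: U | edge u v] x y].

Lemma mem_component U x : x \in component U x.
Proof. by rewrite inE. Qed.

Lemma component_is_component U x : x \notin U -> is_component U (component U x).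
Proof.
move=> xU.
have sub y : y \in component U x -> y \notin U.
  rewrite inE; apply: (connect_closed (P := fun y => y \notin U)) => // u v _.
  by rewrite /= !inE => /andP[/andP[]].
split.
- apply: (@connectedI x); first exact: mem_component.
  move=> K xK cl y; rewrite inE => xy.
  suff [] : y \in K /\ y \in component U x by [].
  apply: (connect_closed (P := fun y => y \in K /\ y \in component U x) _ _ xy).
    by rewrite mem_component.
  move=> u v [uK uC] uv.
  have vC : v \in component U x.
    by rewrite inE in uC; rewrite inE; exact: connect_trans uC (connect1 uv).
  by split=> //; apply: (cl u v) => //; case/andP: uv.
- by apply/disjointP.
- apply/subsetP => y /nbhdP[yC [u uC uy]]; apply: contraNT yC => yU.
  have uU := sub _ uC.
  rewrite inE in uC; rewrite inE; apply: connect_trans uC (connect1 _).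
  by rewrite /= !inE uU yU.
Qed.

Lemma sub_component U E Y x :
    is_component U E -> connected_set Y -> [disjoint Y & U] ->
    x \in Y -> x \in E -> Y \subset E.
Proof.
move=> [_ _ /subsetP nE] cY /disjointP dY xY xE; apply/subsetP => y yY.
apply: contraT => yE.
have [z zY /nE zU] := connected_exit cY xY xE yY yE.
by rewrite (negPf (dY z zY)) in zU.
Qed.

End Connectivity.

Arguments nbhdP {G A v}.

(** * Trees *)

Section Trees.

Definition off_edge (T : sgraph) (x y : T) : rel T :=
  [rel u v | edge u v && ~~ ((u == x) && (v == y) || (u == y) && (v == x))].

(** Every edge is a bridge.  For gluing this is a handier form of acyclicity
    than the absence of cycles, because a walk in a glued graph can be projected
    onto either part. *)
Definition bridged (T : sgraph) := forall x y : T, edge x y ->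
  ~~ connect (off_edge x y) x y.

Definition bridge_tree (T : sgraph) := connected_set [set: T] /\ bridged T.

(** In a cycle [x, y, z, ...] the part after [y] leads back to [x] without the
    edge [xy], which is then not a bridge. *)
Lemma bridge_tree_is_tree T : bridge_tree T -> is_tree T.
Proof.
move=> [cT bT]; split=> // -[|x [|y [|z c]]] //.
rewrite /ucycle /= => /andP[/and3P[xy yz zc]].
rewrite !inE !negb_or => /and4P[/and3P[nxy nxz xc] /andP[nyz yc] zc' _].
have yx : edge y x by rewrite edge_sym.
case/negP: (bT y x yx).
apply: (@connect_trans _ _ z).
  by apply: connect1; rewrite /off_edge /= yz eqxx
    [z == x]eq_sym (negPf nxz) [y == x]eq_sym (negPf nxy).
apply/connectP; exists (rcons c x); last by rewrite last_rcons.
have : all (fun u => u != y) (z :: rcons c x).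
  rewrite /= all_rcons [z == y]eq_sym nyz nxy /=.
  by apply/allP => u uc; apply: contraNneq yc => <-.
move=> all_y; apply: (sub_in_path _ all_y zc).
by rewrite /off_edge => u v uy vy /= ->; rewrite (negPf uy) (negPf vy) andbF.
Qed.

Lemma bridge_tree_unit : bridge_tree unit_graph.
Proof.
split; last by [].
by apply: (@connectedI _ (tt : unit_graph)) => // K ttK _ [].
Qed.

Variables (T1 T2 : sgraph) (t1 : T1) (t2 : T2).

Definition glue_edge : rel (T1 + T2) := fun u v =>
  match u, v with
  | inl a, inl b => edge a b
  | inr a, inr b => edge a b
  | inl a, inr b => (a == t1) && (b == t2)
  | inr a, inl b => (b == t1) && (a == t2)
  end.

Lemma glue_edge_sym : symmetric glue_edge.
Proof. by move=> [a|a] [b|b] //=; rewrite edge_sym. Qed.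

Lemma glue_edge_irrefl : irreflexive glue_edge.
Proof. by move=> [a|a] /=; rewrite edge_irrefl. Qed.

Definition glue : sgraph := SGraph glue_edge_sym glue_edge_irrefl.

(** A walk around an edge of one part projects to that part, all of the other
    part going to the gluing vertex; a walk around the new edge projects to the
    two-point graph without edges. *)
Lemma bridge_tree_glue : bridge_tree T1 -> bridge_tree T2 -> bridge_tree glue.
Proof.
move=> [c1 b1] [c2 b2]; split.
  apply: (@connectedI glue (inl t1)) => // K t1K cl.
  have K1 a : inl a \in K.
    apply: (connected_ind (P := fun a => inl a \in K) c1 (in_setT t1) t1K) => //.
    by move=> u v _ _ uv; apply: cl; rewrite ?inE.
  have t2K : inr t2 \in K.
    by apply: (cl _ _ _ _ _ t1K); rewrite ?inE //= !eqxx.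
  have K2 a : inr a \in K.
    apply: (connected_ind (P := fun a => inr a \in K) c2 (in_setT t2) t2K) => //.
    by move=> u v _ _ uv; apply: cl; rewrite ?inE.
  by move=> [a|a] _.
have bC (x y : glue) : edge x y ->
   ~~ connect (off_edge x y) x y -> ~~ connect (off_edge y x) y x.
  move=> xy; apply: contra; rewrite sym_connect_sym.
    by apply: connect_sub => u v uv; apply: connect1; move: uv; rewrite /off_edge /= orbC.
  by move=> u v; rewrite /off_edge /= glue_edge_sym orbC
       [(v == x) && _]andbC [(v == y) && _]andbC.
have b12 : ~~ connect (off_edge (inl t1 : glue) (inr t2)) (inl t1) (inr t2).
  apply/negP => p12.
  pose side (z : glue) := if z is inl _ then true else false.
  suff /connectP[[|b p]] : connect [rel _ _ | false] true false by [].
  apply: (connect_proj (f := side) _ p12) => -[u|u] [v|v] /=; try by left.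
    by case/andP => /andP[/eqP-> /eqP->]; rewrite !eqxx.
  by case/andP => /andP[/eqP-> /eqP->]; rewrite !eqxx.
move=> [a|a] [b|b] /=.
- move=> ab; apply: contra (b1 _ _ ab).
  apply: (connect_proj (f := fun z : glue => if z is inl a then a else t1)).
  move=> [u|u] [v|v] /= /andP[].
  + by move=> uv uvN; right; apply/andP.
  + by case/andP => /eqP-> _ _; left.
  + by case/andP => /eqP-> _ _; left.
  + by left.
- by case/andP => /eqP-> /eqP->; exact: b12.
- case/andP => /eqP-> /eqP->; apply: bC; last exact: b12.
  by rewrite /= !eqxx.
- move=> ab; apply: contra (b2 _ _ ab).
  apply: (connect_proj (f := fun z : glue => if z is inr a then a else t2)).
  move=> [u|u] [v|v] /= /andP[].
  + by left.
  + by case/andP => _ /eqP-> _; left.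
  + by case/andP => _ /eqP-> _; left.
  + by move=> uv uvN; right; apply/andP.
Qed.

End Trees.

(** * Linkages *)

Section Linkage.
Variable G : sgraph.
Implicit Types (K L S W X : {set G}).

(** Think of [K] as the part of [W] behind a separator: the separator is the
    set of vertices through which [K] can be entered from [X] inside [W]. *)
Definition border W X K :=
  [set v in K | (v \in X) || [exists u in W :\: K, edge v u]].

Lemma borderP W X K v :
  reflect (v \in K /\ (v \in X \/ exists2 u, u \in W :\: K & edge v u))
          (v \in border W X K).
Proof.
rewrite inE; apply: (iffP andP) => -[vK].
  by case/orP => [|/exists_inP]; split; auto.
by move=> [-> //|/exists_inP ->]; rewrite orbT.
Qed.

Lemma border_submodular W X K L :
  #|border W X (K :|: L)| + #|border W X (K :&: L)| <=
  #|border W X K| + #|border W X L|.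
Proof.
rewrite -[leqLHS]cardsUI -[leqRHS]cardsUI; apply: leq_add; apply: subset_leq_card.
  apply/subsetP => v; rewrite inE => /orP[] /borderP[].
    move=> vKL out; rewrite inE; case/setUP: vKL => [vK|vL]; apply/orP.
      left; apply/borderP; split=> //; case: out => [vX|[u uKL vu]]; [by left|right].
      by exists u => //; move: uKL; rewrite !inE negb_or => /andP[/andP[-> _]].
    right; apply/borderP; split=> //; case: out => [vX|[u uKL vu]]; [by left|right].
    by exists u => //; move: uKL; rewrite !inE negb_or => /andP[/andP[_ ->]].
  move=> /setIP[vK vL] out; rewrite inE; apply/orP.
  case: out => [vX|[u uKL vu]]; first by left; apply/borderP; auto.
  move: uKL; rewrite [u \in _]inE => /andP[]; rewrite inE negb_and.
  by case/orP=> [uK|uL] uW; [left|right]; apply/borderP; split=> //; right;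
    exists u; rewrite // inE ?uK ?uL.
apply/subsetP => v /setIP[/borderP[vU outU] /borderP[/setIP[vK vL] _]].
case: outU => [vX|[u]]; first by apply/setIP; split; apply/borderP; auto.
rewrite !inE negb_or => /andP[/andP[uK uL] uW] vu; rewrite vK vL /=.
by apply/andP; split; apply/orP; right;
  apply/exists_inP; exists u => //; rewrite inE ?uK ?uL.
Qed.

(** Menger's theorem for the graph induced on [W], with connected sets instead
    of paths.  A vertex [s] of [S] outside [X] is removed, and a neighbour [u]
    takes its place.  If no neighbour could do so, each one outside [S] would
    lie in some [K] that contains the rest of [S] and has a border smaller than
    [S].  By submodularity the union of these sets would also have a small
    border, and adding [s] to it would not enlarge its border, against the
    hypothesis on [S]. *)
Lemma linkage W X S :
    S \subset W ->
    (forall K, S \subset K -> K \subset W -> #|S| <= #|border W X K|) ->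
  exists phi : G -> {set G},
    [/\ forall s, s \in S ->
          [/\ s \in phi s, connected_set (phi s), phi s \subset W
            & exists2 x, x \in phi s & x \in X]
      & forall s s', s \in S -> s' \in S -> s != s' -> [disjoint phi s & phi s']].
Proof.
have [n le_n] := ubnP #|W|; elim: n W S le_n => // n IHn W S le_n sSW hyp.
have [/subsetP SX|] := boolP (S \subset X).
  exists (fun s => [set s]); split=> [s sS | s s' _ _ ne].
    split; rewrite ?set11 ?sub1set //; last by exists s; rewrite ?set11 // SX.
      exact: connected1.
    exact: (subsetP sSW).
  by apply/disjointP => x /set1P->; rewrite inE.
case/subsetPn => s sS sX.
pose W' := W :\ s; pose S0 := S :\ s.
have sW : s \in W by exact: (subsetP sSW).
have cS : #|S| = #|S0|.+1 by rewrite (cardsD1 s S) sS.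
have lower K : S0 \subset K -> K \subset W' -> #|S0| <= #|border W' X K|.
  move=> sSK sKW.
  have := hyp (s |: K); rewrite cS -(setD1K sS) setUS // => /(_ isT).
  have -> : s |: K \subset W.
    by rewrite subUset sub1set sW (subset_trans sKW) // subD1set.
  move=> /(_ isT) /leq_trans /(_ (subset_leq_card (_ : _ \subset s |: border W' X K))).
  move=> le; rewrite -ltnS; apply: leq_trans (le _) _; last first.
    by rewrite cardsU1; case: (_ \notin _).
  apply/subsetP => v /borderP[]; rewrite !inE; case: eqP => //= _ vK out.
  rewrite vK; case: out => [->//|[u]]; rewrite !inE negb_or => /andP[/andP[us uK] uW] vu.
  by apply/orP; right; apply/exists_inP; exists u; rewrite // !inE us uK uW.
have [u [us uW' uS ok]] : exists u, [/\ edge s u, u \in W', u \notin S &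
   forall K, u |: S0 \subset K -> K \subset W' -> #|S| <= #|border W' X K|].
  apply: contrapT => none.
  (* the sets with border below #|S| are closed under union: take a largest *)
  pose F K := [&& S0 \subset K, K \subset W' & #|border W' X K| <= #|S0|].
  have FS0 : F S0.
    rewrite /F subxx setSD //=; apply: subset_leq_card.
    by apply/subsetP => v /borderP[].
  have FU K L : F K -> F L -> F (K :|: L).
    move=> /and3P[SK KW bK] /and3P[SL LW bL]; apply/and3P; split.
    - exact: subset_trans SK (subsetUl _ _).
    - by rewrite subUset KW.
    - rewrite -(leq_add2r #|S0|); apply: leq_trans (leq_add bK bL).
      apply: leq_trans (border_submodular W' X K L); rewrite leq_add2l.
      by apply: lower; rewrite ?subsetI ?SK // (subset_trans (subsetIl _ _)).
  have [K /maxsetP[FK maxK] _] := @maxset_exists _ F S0 FS0.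
  have nbrK u : edge s u -> u \in W' -> u \in K.
    move=> su uW.
    have [uS|uS] := boolP (u \in S).
      case/and3P: FK => /subsetP SK _ _; apply: SK.
      by move: uW; rewrite !inE uS => /andP[->].
    have [L [uL LW bL]] : exists L, [/\ u |: S0 \subset L, L \subset W' &
        #|border W' X L| < #|S|].
      apply: contrapT => noL; apply: none; exists u; split=> // L uL LW.
      by rewrite leqNgt; apply/negP => lt; apply: noL; exists L.
    move: uL; rewrite subUset sub1set => /andP[uL SL].
    have FL : F L by apply/and3P; split=> //; rewrite -ltnS -cS.
    have <- : K :|: L = K by apply: maxK (FU _ _ FK FL) (subsetUl _ _).
    by rewrite inE uL orbT.
  case/and3P: FK => SK KW bK.
  have : #|S| <= #|border W X (s |: K)|.
    apply: hyp; first by rewrite -(setD1K sS) setUS.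
    by rewrite subUset sub1set sW (subset_trans KW) // subD1set.
  rewrite leqNgt cS ltnS => /negP; apply; apply: leq_trans bK.
  apply: subset_leq_card; apply/subsetP => v /borderP[].
  rewrite !inE => /orP[/eqP->|vK] out.
    case: out => [|[u]]; first by rewrite (negPf sX).
    rewrite !inE negb_or => /andP[/andP[us uK] uW] su.
    by rewrite nbrK // !inE us in uK.
  rewrite vK; case: out => [->//|[u]]; rewrite !inE negb_or => /andP[/andP[us uK] uW] vu.
  by apply/orP; right; apply/exists_inP; exists u; rewrite // !inE us uK uW.
have cS' : #|u |: S0| = #|S|.
  by rewrite cardsU1 cS inE (negPf uS) andbF.
have [|||phi [phiP phiD]] := IHn W' (u |: S0) _ _ _.
- by rewrite -ltnS (leq_trans _ le_n) // (cardsD1 s W) sW.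
- by rewrite subUset sub1set uW' setSD.
- by move=> K; rewrite cS'; exact: ok.
have uT : u \in u |: S0 by rewrite setU11.
have inT t : t \in S -> t != s -> t \in u |: S0.
  by move=> tS ts; rewrite !inE tS ts orbT.
have offs t : t \in u |: S0 -> s \notin phi t.
  move=> /phiP[_ _ /subsetP pW _]; apply/negP => /pW; by rewrite !inE eqxx.
have nu t : t \in S -> t != u by move=> tS; apply: contraNneq uS => <-.
have disj t : t \in S -> t != s -> [disjoint s |: phi u & phi t].
  move=> tS ts; have tT := inT t tS ts.
  apply/disjointP => x /setU1P[->|xu]; first exact: offs.
  suff /disjointP : [disjoint phi u & phi t] by apply.
  by apply: phiD => //; rewrite eq_sym; exact: nu.
exists (fun t => if t == s then s |: phi u else phi t); split=> [t tS | t t' tS tS' ne].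
  case: eqP => [->|/eqP ts].
    have [pu pc pW [x xp xX]] := phiP u uT.
    split; first exact: setU11.
    - apply: connectedU => //; first exact: connected1.
      by exists s, u; rewrite set11 us orbT.
    - by rewrite subUset sub1set sW (subset_trans pW) // subD1set.
    - by exists x; rewrite // inE xp orbT.
  have [pu pc pW ex] := phiP t (inT t tS ts).
  by split=> //; apply: (subset_trans pW); rewrite subD1set.
have [ts|ts] := eqVneq t s; have [ts'|ts'] := eqVneq t' s.
- by rewrite ts ts' eqxx in ne.
- exact: disj.
- by rewrite disjoint_sym; exact: disj.
- by apply: phiD => //; exact: inT.
Qed.

End Linkage.

(** * Partial tree decompositions *)

Lemma connected_imset (T T' : sgraph) (f : T -> T') (A : {set T}) :
    (forall u v, edge u v -> edge (f u) (f v)) ->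
  connected_set A -> connected_set (f @: A).
Proof.
move=> fe cA; have [/set0Pn[x xA] _] := cA.
apply: (@connectedI _ (f x)); first exact: imset_f.
move=> K xK cl _ /imsetP[y yA ->].
apply: (connected_ind (P := fun y => f y \in K) cA xA xK) yA => u v uA vA uv.
by apply: cl; [exact: imset_f | exact: imset_f | exact: fe].
Qed.

Section PartialDecomposition.
Variables (G : sgraph) (m : nat).
Implicit Types (C D E P Q S U X Y : {set G}) (u v w x y : G).

(** A tree decomposition of the graph induced on [U] with bags of at most [m]
    vertices, to which every component of the rest could be attached as a leaf
    with bag [E :|: nbhd E]. *)
Record partial_decomposition (T : sgraph) (bag : T -> {set G}) U : Prop :=
  PartialDecomposition {
    pd_tree : bridge_tree T;
    pd_sub : forall t, bag t \subset U;
    pd_size : forall t, #|bag t| <= m;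
    pd_conn : forall x, x \in U -> connected_set [set t | x \in bag t];
    pd_edge : forall x y, x \in U -> y \in U -> edge x y ->
      exists t, (x \in bag t) && (y \in bag t);
    pd_comp : forall E, is_component U E -> exists t, nbhd E \subset bag t }.

Definition trace (T : sgraph) (bag : T -> {set G}) Y :=
  [set t | ~~ [disjoint Y & bag t]].

Lemma traceP (T : sgraph) (bag : T -> {set G}) Y t :
  reflect (exists2 y, y \in Y & y \in bag t) (t \in trace bag Y).
Proof.
rewrite inE -setI_eq0. apply: (iffP (set0Pn _)) => -[y].
  by rewrite inE => /andP[]; exists y.
by move=> yY yt; exists y; rewrite inE yY.
Qed.

Lemma nbhd_component_meet U E Y y z :
    is_component U E -> connected_set Y -> y \in Y -> y \in E ->
    z \in Y -> z \in U -> exists2 w, w \in Y & w \in nbhd E.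
Proof.
move=> [_ /disjointP dE _] cY yY yE zY zU.
apply: (connected_exit cY yY yE zY).
by apply/negP => /dE; rewrite zU.
Qed.

(** A connected set that meets [U] leaves a connected trace on the tree although
    it may leave [U]: an excursion through a component of the complement starts
    and ends in the neighbourhood of that component, which is in a single bag. *)
Lemma trace_connected T bag U Y z :
    @partial_decomposition T bag U -> connected_set Y -> z \in Y -> z \in U ->
  connected_set (trace bag Y).
Proof.
move=> pd cY zY zU.
have [/set0Pn[t0]] := pd_conn pd zU; rewrite inE => zt0 _.
apply: (@connectedI _ t0); first by apply/traceP; exists z.
move=> K t0K cl.
have spread y t t' : y \in Y -> y \in bag t -> t \in K -> y \in bag t' -> t' \in K.
  move=> yY yt tK yt'.
  have yU : y \in U by exact: (subsetP (pd_sub pd t)).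
  apply: (@connected_ind _ _ (fun t => t \in K) t t' (pd_conn pd yU)) => //.
  - by rewrite inE.
  - move=> a b; rewrite !inE => ya yb; apply: cl; apply/traceP; exists y => //.
  - by rewrite inE.
(* a vertex outside U is located by a bag with the neighbourhood of its component *)
pose good y := exists2 t, t \in K &
  y \in bag t \/ (y \notin U /\ nbhd (component U y) \subset bag t).
have goodY y : y \in Y -> good y.
  have good_z : good z by exists t0; auto.
  apply: (connected_ind (P := good) cY zY good_z) => a b aY bY ab [t tK at_].
  have [bU|bU] := boolP (b \in U); case: at_ => [at_|[aU /subsetP nt]].
  - have aU : a \in U by exact: (subsetP (pd_sub pd t)).
    have [t' /andP[at' bt']] := pd_edge pd aU bU ab.
    by exists t'; [exact: (spread a t) | left].
  - exists t => //; left; apply: nt; apply/nbhdP; split.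
      have [_ /disjointP dE _] := component_is_component aU.
      by apply/negP => /dE; rewrite bU.
    by exists a => //; exact: mem_component.
  - have aU : a \in U by exact: (subsetP (pd_sub pd t)).
    have cE := component_is_component bU.
    have [t' nt'] := pd_comp pd cE; exists t'; last by right.
    apply: (spread a t) => //; apply: (subsetP nt'); apply/nbhdP; split.
      by have [_ /disjointP dE _] := cE; apply/negP => /dE; rewrite aU.
    by exists b; [exact: mem_component | rewrite edge_sym].
  - exists t => //; right; split=> //; apply/subsetP => w /nbhdP[wE [u uE uw]].
    have cE := component_is_component aU.
    have bE : b \in component U a.
      have [_ _ nE] := cE; apply: contraNT bU => bE; apply: (subsetP nE).
      by apply/nbhdP; split=> //; exists a => //; exact: mem_component.
    have sub : component U b \subset component U a.
      have [cB dB _] := component_is_component bU.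
      by apply: sub_component cE cB dB (mem_component _ _) bE.
    have sub' : component U a \subset component U b.
      have [cA dA _] := cE.
      by apply: sub_component (component_is_component bU) cA dA bE (mem_component _ _).
    apply: nt; apply/nbhdP; split; first by apply: contra wE; exact: (subsetP sub').
    by exists u => //; exact: (subsetP sub).
move=> t /traceP[y yY yt]; have [t' t'K [yt'|[yU _]]] := goodY y yY.
  exact: (spread y t').
by rewrite (subsetP (pd_sub pd t) _ yt) in yU.
Qed.

(** Cutting a partial decomposition along [S].  The part kept is [S :|: Q], where
    [Q] lies on the other side of [S] from the component [C].  Each [s] in [S] is
    replaced by a connected set [phi s] reaching the neighbourhood of [C], as if
    [phi s] were contracted to [s].  As these sets are disjoint, no bag grows;
    and the bag that contains the neighbourhood of [C] now contains [S]. *)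
Section Transfer.
Variables (T : sgraph) (bag : T -> {set G}) (U C S Q : {set G}) (tC : T).
Variable phi : G -> {set G}.
Hypotheses (pd : partial_decomposition bag U) (cC : is_component U C)
  (nC : nbhd C \subset bag tC).
Hypotheses (dSQ : [disjoint S & Q]) (dCQ : [disjoint C & Q]).
Hypothesis phiP : forall s, s \in S ->
  [/\ s \in phi s, connected_set (phi s), [disjoint phi s & Q]
    & exists2 x, x \in phi s & x \in nbhd C].
Hypothesis phiD : forall s s', s \in S -> s' \in S -> s != s' ->
  [disjoint phi s & phi s'].

Let psi x := if x \in S then phi x else [set x].

Definition transfer t := [set x in S :|: Q | t \in trace bag (psi x)].

Let psiS s : s \in S -> psi s = phi s. Proof. by rewrite /psi => ->. Qed.

Let psiQ x : x \in Q -> psi x = [set x].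
Proof. by rewrite /psi; case: ifP => // xS xQ; have := disjointP dSQ _ xS; rewrite xQ. Qed.

Let psi_self x : x \in psi x.
Proof. by rewrite /psi; case: ifP => [/phiP[]|_] //; rewrite set11. Qed.

Let psi_conn x : connected_set (psi x).
Proof. by rewrite /psi; case: ifP => [/phiP[]|_] //; exact: connected1. Qed.

Let psiU x : x \in S :|: (Q :&: U) -> exists2 z, z \in psi x & z \in U.
Proof.
rewrite inE => /orP[xS|/setIP[xQ xU]]; last by exists x.
have [_ _ _ [z zx zC]] := phiP xS; exists z; rewrite ?psiS //.
by have [_ _ /subsetP] := cC; apply.
Qed.

Let psiD x y z : x \in S :|: Q -> y \in S :|: Q ->
  z \in psi x -> z \in psi y -> x = y.
Proof.
move=> /setUP[xS|xQ] /setUP[yS|yQ].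
- rewrite !psiS // => zx zy; apply/eqP; apply/negPn/negP => /(phiD xS yS).
  by move/disjointP => /(_ z zx); rewrite zy.
- rewrite psiS // psiQ // => zx /set1P zy; rewrite {}zy in zx.
  by have [_ _ /disjointP/(_ y zx)] := phiP xS; rewrite yQ.
- rewrite [psi y]psiS // psiQ // => /set1P-> xy.
  by have [_ _ /disjointP/(_ x xy)] := phiP yS; rewrite xQ.
- by rewrite !psiQ // => /set1P-> /set1P.
Qed.

Let mem_transfer x t z :
  x \in S :|: Q -> z \in psi x -> z \in bag t -> x \in transfer t.
Proof. by move=> xSQ zx zt; rewrite inE xSQ; apply/traceP; exists z. Qed.

Lemma transfer_sub t : transfer t \subset S :|: (Q :&: U).
Proof.
apply/subsetP => x; rewrite inE => /andP[xSQ /traceP[z zx zt]].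
case/setUP: xSQ => [xS|xQ]; first by rewrite inE xS.
rewrite psiQ // in zx; rewrite -(set1P zx) !inE (set1P zx) xQ.
by rewrite -(set1P zx) (subsetP (pd_sub pd t) _ zt) orbT.
Qed.

Lemma transfer_size t : #|transfer t| <= m.
Proof.
apply: leq_trans (pd_size pd t).
pose g x := odflt x [pick z in psi x :&: bag t].
have gP x : x \in transfer t -> g x \in psi x /\ g x \in bag t.
  rewrite inE => /andP[_ /traceP[z zx zt]]; rewrite /g; case: pickP => [w|].
    by move=> /setIP[].
  by move/(_ z); rewrite !inE zx zt.
have ginj : {in transfer t &, injective g}.
  move=> x y xt yt gxy; have [gx _] := gP x xt; have [gy _] := gP y yt.
  move: xt yt; rewrite !inE => /andP[xSQ _] /andP[ySQ _].
  by apply: (psiD _ _ gx); rewrite ?inE ?gxy.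
rewrite -(card_in_imset ginj); apply: subset_leq_card.
by apply/subsetP => _ /imsetP[x /gP[_ xt] ->].
Qed.

Lemma transfer_root : S \subset transfer tC.
Proof.
apply/subsetP => s sS; have [_ _ _ [x xs xC]] := phiP sS.
by apply: (mem_transfer (z := x)); rewrite ?inE ?sS ?psiS // (subsetP nC).
Qed.

Lemma transfer_conn x :
  x \in S :|: (Q :&: U) -> connected_set [set t | x \in transfer t].
Proof.
move=> xU; have [z zx zU] := psiU xU.
have -> : [set t | x \in transfer t] = trace bag (psi x).
  apply/setP => t; rewrite !inE; suff -> : (x \in S) || (x \in Q) by [].
  by move: xU; rewrite !inE => /orP[->|/andP[-> _]] //; rewrite orbT.
exact: trace_connected pd (psi_conn x) zx zU.
Qed.

Let subSQ x : x \in S :|: (Q :&: U) -> x \in S :|: Q.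
Proof. by rewrite !inE => /orP[->|/andP[->]] //; rewrite orbT. Qed.

Let meet_nbhd E x y : is_component U E -> x \in S :|: (Q :&: U) ->
  y \in psi x -> y \in E -> exists2 w, w \in psi x & w \in nbhd E.
Proof.
move=> cE xU yx yE; have [z zx zU] := psiU xU.
exact: nbhd_component_meet cE (psi_conn x) yx yE zx zU.
Qed.

Lemma transfer_edge x y :
    x \in S :|: (Q :&: U) -> y \in S :|: (Q :&: U) -> edge x y ->
  exists t, (x \in transfer t) && (y \in transfer t).
Proof.
wlog yU : x y / y \in U => [hw xU yU xy|].
  have [yU'|yU'] := boolP (y \in U); first exact: hw.
  have [xU'|xU'] := boolP (x \in U).
    have [|t] := hw y x xU' yU xU; first by rewrite edge_sym.
    by exists t; rewrite andbC.
  have inS z : z \in S :|: (Q :&: U) -> z \notin U -> z \in S.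
    by rewrite !inE => /orP[//|/andP[_ ->]].
  by exists tC; rewrite !(subsetP transfer_root) //; apply: inS.
move=> xU yU' xy; have [xU'|xU'] := boolP (x \in U).
  have [t /andP[xt yt]] := pd_edge pd xU' yU xy; exists t.
  by rewrite (mem_transfer (z := x)) ?(mem_transfer (z := y)) ?subSQ.
have cE := component_is_component xU'.
have [t nt] := pd_comp pd cE; exists t.
have [w wx wE] := meet_nbhd cE xU (psi_self x) (mem_component U x).
rewrite (mem_transfer _ wx) ?subSQ ?(subsetP nt) //=.
rewrite (mem_transfer (z := y)) ?subSQ ?(subsetP nt) //.
apply/nbhdP; split; last by exists x; rewrite ?mem_component.
by have [_ /disjointP dE _] := cE; apply/negP => /dE; rewrite yU.
Qed.

(** A neighbour [y] of [E] in [S] may lie in the old component around [E].  Then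
    [phi y] has to leave this component, hence meets its neighbourhood, so that
    [y] enters the bag containing that neighbourhood. *)
Lemma transfer_component E :
    connected_set E -> E \subset Q -> [disjoint E & U] ->
    nbhd E \subset S :|: (Q :&: U) ->
  (exists E', [/\ is_component U E', E' <> C & E \subset E']) /\
  exists t, nbhd E \subset transfer t.
Proof.
move=> cE /subsetP EQ dE /subsetP nE; have [/set0Pn[x xE] _] := cE.
have xU : x \notin U by exact: (disjointP dE).
have cE' := component_is_component xU.
have sE : E \subset component U x.
  exact: sub_component cE' cE dE xE (mem_component _ _).
split.
  exists (component U x); split=> // eC.
  have := disjointP dCQ x; rewrite -eC mem_component => /(_ isT).
  by rewrite EQ.
have [t nt] := pd_comp pd cE'; exists t; apply/subsetP => y yE.
have yU := nE y yE; have [yE' [z zE zy]] := nbhdP yE.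
have [yC|yC] := boolP (y \in component U x).
  have [w wy wE] := meet_nbhd cE' yU (psi_self y) yC.
  by apply: (mem_transfer _ wy); rewrite ?subSQ ?(subsetP nt).
apply: (mem_transfer (z := y)); rewrite ?subSQ ?(subsetP nt) //.
by apply/nbhdP; split=> //; exists z => //; exact: (subsetP sE).
Qed.

End Transfer.
End PartialDecomposition.

(** * Duality between treewidth and brambles *)

Section Duality.
Variables (G : sgraph) (m : nat).
Implicit Types (C D E K L P Q S U X : {set G}) (u v w x y : G).

(** Both partial decompositions are cut along [S], the first one keeping [Q] and
    the second one keeping [P].  After the cut each has a bag containing [S], and
    they are glued at these bags. *)
Lemma glue_partial_decompositions T1 bag1 U1 C T2 bag2 U2 D S P Q
    (phi1 phi2 : G -> {set G}) :
    @partial_decomposition G m T1 bag1 U1 -> is_component U1 C ->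
    @partial_decomposition G m T2 bag2 U2 -> is_component U2 D ->
    (forall x, [|| x \in S, x \in P | x \in Q]) ->
    [disjoint S & P] -> [disjoint S & Q] -> [disjoint P & Q] ->
    (forall x y, x \in P -> y \in Q -> ~~ edge x y) ->
    C \subset P -> D \subset Q ->
    (forall s, s \in S ->
      [/\ s \in phi1 s, connected_set (phi1 s), [disjoint phi1 s & Q]
        & exists2 x, x \in phi1 s & x \in nbhd C]) ->
    (forall s s', s \in S -> s' \in S -> s != s' -> [disjoint phi1 s & phi1 s']) ->
    (forall s, s \in S ->
      [/\ s \in phi2 s, connected_set (phi2 s), [disjoint phi2 s & P]
        & exists2 x, x \in phi2 s & x \in nbhd D]) ->
    (forall s s', s \in S -> s' \in S -> s != s' -> [disjoint phi2 s & phi2 s']) ->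
  exists T bag U, @partial_decomposition G m T bag U /\
    forall E, is_component U E -> exists2 E' : {set G}, E \subset E' &
      (is_component U1 E' /\ E' <> C) \/ (is_component U2 E' /\ E' <> D).
Proof.
move=> pd1 cC pd2 cD cover dSP dSQ dPQ noPQ CP DQ phi1P phi1D phi2P phi2D.
have [tC nC] := pd_comp pd1 cC; have [tD nD] := pd_comp pd2 cD.
have dCQ : [disjoint C & Q] by exact: disjointWl CP dPQ.
have dDP : [disjoint D & P].
  by rewrite disjoint_sym; apply: disjointWr DQ dPQ.
pose bag1' := transfer bag1 S Q phi1; pose bag2' := transfer bag2 S P phi2.
pose bag (t : glue tC tD) := match t with inl t => bag1' t | inr t => bag2' t end.
pose U := S :|: (Q :&: U1) :|: (P :&: U2).
have sub1 t : bag1' t \subset S :|: (Q :&: U1).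
  exact: (transfer_sub phi1 pd1 dSQ t).
have sub2 t : bag2' t \subset S :|: (P :&: U2).
  exact: (transfer_sub phi2 pd2 dSP t).
have root1 : S \subset bag1' tC by exact: (transfer_root nC phi1P).
have root2 : S \subset bag2' tD by exact: (transfer_root nD phi2P).
have notP x : x \in Q -> x \notin P.
  by move: dPQ; rewrite disjoint_sym => /disjointP; apply.
have notQ x : x \in P -> x \notin Q by exact: (disjointP dPQ).
have side x : x \in U -> x \in S :|: (Q :&: U1) \/ x \in S :|: (P :&: U2).
  by rewrite /U !inE => /orP[->|->]; [left|right; rewrite orbT].
have conn1 x : x \in S :|: (Q :&: U1) ->
    connected_set ((inl : T1 -> glue tC tD) @: [set t | x \in bag1' t]).
  move=> xU; apply: connected_imset => //.
  exact: (transfer_conn pd1 cC phi1P xU).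
have conn2 x : x \in S :|: (P :&: U2) ->
    connected_set ((inr : T2 -> glue tC tD) @: [set t | x \in bag2' t]).
  move=> xU; apply: connected_imset => //.
  exact: (transfer_conn pd2 cD phi2P xU).
have inS x : x \in S :|: (Q :&: U1) -> x \in S :|: (P :&: U2) -> x \in S.
  rewrite !inE => /orP[//|/andP[xQ _]] /orP[//|/andP[xP _]].
  by rewrite (negPf (notQ x xP)) in xQ.
have nodes x : [set t | x \in bag t] =
    (inl : T1 -> glue tC tD) @: [set t | x \in bag1' t] :|:
    (inr : T2 -> glue tC tD) @: [set t | x \in bag2' t].
  apply/setP => t; rewrite !inE; apply/idP/orP.
    by case: t => t xt; [left|right]; apply: imset_f; rewrite inE.
  by case=> /imsetP[t']; rewrite inE => xt ->.
have comp E : is_component U E -> E \subset Q \/ E \subset P.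
  move=> [cE /disjointP dE _]; have [/set0Pn[x xE] _] := cE.
  have nS y : y \in E -> y \notin S.
    by move/dE; apply: contra => yS; rewrite !inE yS.
  have := cover x; rewrite (negPf (nS x xE)) /= => /orP[xP|xQ]; [right|left];
    apply/subsetP => y.
    apply: (connected_ind (P := fun y => y \in P) cE xE xP) => u v uE vE uv uP.
    have := cover v; rewrite (negPf (nS v vE)) /= => /orP[//|vQ].
    by have := noPQ u v uP vQ; rewrite uv.
  apply: (connected_ind (P := fun y => y \in Q) cE xE xQ) => u v uE vE uv uQ.
  have := cover v; rewrite (negPf (nS v vE)) /= => /orP[vP|//].
  by have := noPQ v u vP uQ; rewrite edge_sym uv.
have compQ E : is_component U E -> E \subset Q ->
  [/\ connected_set E, [disjoint E & U1] & nbhd E \subset S :|: (Q :&: U1)].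
  move=> [cE /disjointP dE /subsetP nE] /subsetP EQ; split=> //.
    apply/disjointP => x xE; have := dE x xE; apply: contra => xU1.
    by rewrite !inE xU1 EQ // orbT.
  apply/subsetP => y yE; have := nE y yE; rewrite !inE => /orP[//|/andP[yP _]].
  have [_ [z zE zy]] := nbhdP yE.
  by have := noPQ y z yP (EQ z zE); rewrite edge_sym zy.
have compP E : is_component U E -> E \subset P ->
  [/\ connected_set E, [disjoint E & U2] & nbhd E \subset S :|: (P :&: U2)].
  move=> [cE /disjointP dE /subsetP nE] /subsetP EP; split=> //.
    apply/disjointP => x xE; have := dE x xE; apply: contra => xU2.
    by rewrite !inE xU2 EP // orbT.
  apply/subsetP => y yE; have := nE y yE; rewrite !inE.
  move=> /orP[/orP[->//|/andP[yQ _]]|-> ]; last by rewrite orbT.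
  have [_ [z zE zy]] := nbhdP yE.
  by have := noPQ z y (EP z zE) yQ; rewrite zy.
exists (glue tC tD), bag, U; split; first split.
- exact: bridge_tree_glue (pd_tree pd1) (pd_tree pd2).
- case=> t /=; first by apply: subset_trans (sub1 t) (subsetUl _ _).
  by apply: subset_trans (sub2 t) _; rewrite /U -setUA setUS // subsetUr.
- case=> t /=; first exact: (transfer_size pd1 dSQ phi1P phi1D).
  exact: (transfer_size pd2 dSP phi2P phi2D).
- move=> x xU; rewrite nodes.
  have empty1 : x \notin S :|: (Q :&: U1) -> [set t | x \in bag1' t] = set0.
    move=> xN; apply/setP => t; rewrite in_set0 inE; apply: contraNF xN.
    exact: (subsetP (sub1 t)).
  have empty2 : x \notin S :|: (P :&: U2) -> [set t | x \in bag2' t] = set0.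
    move=> xN; apply/setP => t; rewrite in_set0 inE; apply: contraNF xN.
    exact: (subsetP (sub2 t)).
  have [x1|x1] := boolP (x \in S :|: (Q :&: U1)); last first.
    case: (side x xU) => [x1'|x2]; first by rewrite x1' in x1.
    by rewrite empty1 // imset0 set0U; exact: conn2.
  have [x2|x2] := boolP (x \in S :|: (P :&: U2)); last first.
    by rewrite empty2 // imset0 setU0; exact: conn1.
  apply: connectedU (conn1 x x1) (conn2 x x2) _.
  have xS := inS x x1 x2; exists (inl tC), (inr tD); split.
  + by apply: imset_f; rewrite inE (subsetP root1).
  + by apply: imset_f; rewrite inE (subsetP root2).
  + by rewrite /= !eqxx.
- have e1 x y : x \in S :|: (Q :&: U1) -> y \in S :|: (Q :&: U1) -> edge x y ->
      exists t, (x \in bag t) && (y \in bag t).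
    move=> xU yU xy.
    have [t xyt] := transfer_edge pd1 cC nC phi1P xU yU xy.
    by exists (inl t).
  have e2 x y : x \in S :|: (P :&: U2) -> y \in S :|: (P :&: U2) -> edge x y ->
      exists t, (x \in bag t) && (y \in bag t).
    move=> xU yU xy.
    have [t xyt] := transfer_edge pd2 cD nD phi2P xU yU xy.
    by exists (inr t).
  have inSl z A : z \in S -> z \in S :|: A by rewrite inE => ->.
  move=> x y /side[] /[dup] x' /setUP[xS|/setIP[xT _]]
    /side[] /[dup] y' /setUP[yS|/setIP[yT _]] xy;
    try (by apply: e1 => //; apply: inSl); try (by apply: e2 => //; apply: inSl).
  + by have := noPQ y x yT xT; rewrite edge_sym xy.
  + by have := noPQ x y xT yT; rewrite xy.
- move=> E cE; case: (comp E cE) => sE.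
    have [c d n] := compQ E cE sE.
    have [_ [t nt]] := transfer_component pd1 cC dCQ phi1P c sE d n.
    by exists (inl t).
  have [c d n] := compP E cE sE.
  have [_ [t nt]] := transfer_component pd2 cD dDP phi2P c sE d n.
  by exists (inr t).
- move=> E cE; case: (comp E cE) => sE.
    have [c d n] := compQ E cE sE.
    have [[E' [cE' nE' EE']] _] := transfer_component pd1 cC dCQ phi1P c sE d n.
    by exists E'; auto.
  have [c d n] := compP E cE sE.
  have [[E' [cE' nE' EE']] _] := transfer_component pd2 cD dDP phi2P c sE d n.
  by exists E'; auto.
Qed.

Definition flap E := connected_set E /\ #|nbhd E| <= m.

Definition blocking (B : {set {set G}}) :=
  [/\ forall E, E \in B -> flap E,
      forall E E', E \in B -> flap E' -> E \subset E' -> E' \in B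
    & forall T bag U, @partial_decomposition G m T bag U ->
        exists2 E, E \in B & is_component U E].

Lemma component_flap T bag U E :
  @partial_decomposition G m T bag U -> is_component U E -> flap E.
Proof.
move=> pd cE; split; first by case: cE.
have [t nt] := pd_comp pd cE.
exact: leq_trans (subset_leq_card nt) (pd_size pd t).
Qed.

(** [S] is the inner boundary of a set [K] that contains [D] and its neighbours
    but no vertex of [C], chosen with the least boundary.  If [S] failed to be
    linked to the neighbourhood of [C] on one side, or of [D] on the other, the
    set obstructing the linkage would yield a [K] with a smaller boundary. *)
Lemma linked_separation C D :
    ~ touch C D ->
  exists S P Q (phi1 phi2 : G -> {set G}), [/\
    [/\ forall x, [|| x \in S, x \in P | x \in Q],
       [disjoint S & P], [disjoint S & Q] & [disjoint P & Q]],
    forall x y, x \in P -> y \in Q -> ~~ edge x y,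
    C \subset P /\ D \subset Q,
    (forall s, s \in S ->
      [/\ s \in phi1 s, connected_set (phi1 s), [disjoint phi1 s & Q]
        & exists2 x, x \in phi1 s & x \in nbhd C]) /\
    (forall s s', s \in S -> s' \in S -> s != s' -> [disjoint phi1 s & phi1 s'])
  & (forall s, s \in S ->
      [/\ s \in phi2 s, connected_set (phi2 s), [disjoint phi2 s & P]
        & exists2 x, x \in phi2 s & x \in nbhd D]) /\
    (forall s s', s \in S -> s' \in S -> s != s' -> [disjoint phi2 s & phi2 s'])].
Proof.
move=> ntouch.
pose bd K : {set G} := border [set: G] set0 K.
have bdP K v : reflect (v \in K /\ exists2 u, u \notin K & edge v u) (v \in bd K).
  apply: (iffP (borderP _ _ _ _)) => -[vK]; last first.
    by move=> [u uK vu]; split=> //; right; exists u; rewrite // !inE uK.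
  move=> [|[u]]; first by rewrite inE.
  by rewrite !inE andbT => uK vu; split=> //; exists u.
pose ok K := (D :|: nbhd D \subset K) && [disjoint C & K].
have dCD x : x \in C -> x \notin D.
  by move=> xC; apply/negP => xD; apply: ntouch; exists x, x; rewrite eqxx.
have ok0 : ok (~: C).
  rewrite /ok; apply/andP; split.
    apply/subsetP => x; rewrite !inE => xD; apply/negP => xC.
    case/orP: xD => [xD|/andP[_ /exists_inP[u uD ux]]].
      by have := dCD x xC; rewrite xD.
    by apply: ntouch; exists x, u; rewrite edge_sym ux orbT.
  by apply/disjointP => x; rewrite inE => ->.
case: (@arg_minnP _ (~: C) ok (fun K => #|bd K|) ok0) => K /andP[sDK /disjointP dCK] minK.
pose S := bd K; pose P := ~: K; pose Q := K :\: S.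
have SK : S \subset K by apply/subsetP => v /bdP[].
have nbrD u v : u \in D -> edge u v -> v \in K.
  move=> uD uv; apply: (subsetP sDK); rewrite inE.
  have [//|vD] := boolP (v \in D); apply/nbhdP; split=> //; by exists u.
have DK u : u \in D -> u \in K.
  by move=> uD; apply: (subsetP sDK); rewrite inE uD.
have QK u v : u \in Q -> edge u v -> v \in K.
  move=> /setDP[uK uS] uv; apply: contraNT uS => vK.
  by apply/bdP; split=> //; exists v.
have [phi1 [phi1P phi1D]] : exists phi : G -> {set G},
    [/\ forall s, s \in S ->
          [/\ s \in phi s, connected_set (phi s), phi s \subset ~: Q
            & exists2 x, x \in phi s & x \in nbhd C]
      & forall s s', s \in S -> s' \in S -> s != s' -> [disjoint phi s & phi s']].
  apply: linkage.
    by apply/subsetP => v vS; rewrite in_setC in_setD vS.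
  move=> L SL LQ.
  have okK' : ok ((L :|: K) :\: C).
    apply/andP; split; last by apply/disjointP => x xC; rewrite !inE xC.
    apply: subset_trans sDK _; apply/subsetP => x xK; rewrite !inE xK orbT andbT.
    by apply/negP => /dCK; rewrite xK.
  apply: leq_trans (minK _ okK') (subset_leq_card _).
  apply/subsetP => v /bdP[/setDP[/setUP vLK vC] [u uN vu]].
  have vQ : v \notin Q.
    apply/negP => vQ; case/negP: uN; have uK := QK v u vQ vu.
    by rewrite !inE uK orbT andbT; apply/negP => /dCK; rewrite uK.
  have vL : v \in L.
    case: vLK => // vK; move: vQ; rewrite in_setD vK andbT negbK.
    exact: (subsetP SL).
  move: uN; rewrite in_setD in_setU negb_and negbK => uN.
  apply/borderP; split=> //.
  have [uC|uC] := boolP (u \in C).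
    by left; apply/nbhdP; split=> //; exists u; rewrite // edge_sym.
  move: uN; rewrite (negPf uC) /= negb_or => /andP[uL uK].
  by right; exists u; rewrite // in_setD uL in_setC in_setD (negPf uK) andbF.
have [phi2 [phi2P phi2D]] : exists phi : G -> {set G},
    [/\ forall s, s \in S ->
          [/\ s \in phi s, connected_set (phi s), phi s \subset K
            & exists2 x, x \in phi s & x \in nbhd D]
      & forall s s', s \in S -> s' \in S -> s != s' -> [disjoint phi s & phi s']].
  apply: linkage => // L SL LK.
  pose bL := border K (nbhd D) L; pose K' := D :|: (K :\: L) :|: bL.
  have K'K : K' \subset K.
    apply/subsetP => v; rewrite !inE => /orP[/orP[/DK//|/andP[_ //]]|].
    by case/andP => /(subsetP LK).
  have okK' : ok K'.
    apply/andP; split; last first.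
      apply/disjointP => x xC; apply/negP => /(subsetP K'K) xK.
      by have := dCK x xC; rewrite xK.
    apply/subsetP => v; rewrite /K' inE => /orP[vD|vD]; first by rewrite !inE vD.
    have vK : v \in K by apply: (subsetP sDK); rewrite inE vD orbT.
    have [vL|vL] := boolP (v \in L); last by rewrite !inE vL vK /= orbT.
    by rewrite inE; apply/orP; right; apply/borderP; auto.
  apply: leq_trans (minK _ okK') (subset_leq_card _).
  apply/subsetP => v /bdP[vK' [u uK' vu]].
  have vK := subsetP K'K _ vK'.
  move: uK'; rewrite /K' !in_setU !negb_or => /andP[/andP[uD uKL] ubL].
  have uL : u \in K -> u \in L by move=> uK; move: uKL; rewrite inE uK andbT negbK.
  move: vK'; rewrite /K' !in_setU => /orP[/orP[vD|]|//].
    case/negP: ubL; apply/borderP; split; first by apply: uL; exact: nbrD vu.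
    by left; apply/nbhdP; split=> //; exists v.
  case/setDP=> _ vL; case/negP: (vL); apply: (subsetP SL).
  apply/bdP; split=> //; exists u => //; apply/negP => uK.
  case/negP: ubL; apply/borderP; split; first exact: uL.
  by right; exists v; rewrite ?inE ?vL // edge_sym.
exists S, P, Q, phi1, phi2; split.
- split.
  + by move=> x; rewrite in_setC in_setD; case: (x \in S); case: (x \in K).
  + by apply/disjointP => x /(subsetP SK); rewrite in_setC => ->.
  + by apply/disjointP => x xS; rewrite in_setD xS.
  + by apply/disjointP => x; rewrite in_setC in_setD => /negPf->; rewrite andbF.
- move=> x y xP yQ; apply/negP => xy.
  by move: xP; rewrite inE (QK y x) // edge_sym.
- split; apply/subsetP => x xD.
    by rewrite inE dCK.
  rewrite inE DK // andbT; apply/negP => /bdP[_ [u uK xu]].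
  by rewrite (nbrD x u) in uK.
- split=> // s /phi1P[? ? sub ?]; split=> //.
  by rewrite disjoints_subset.
- split=> // s /phi2P[? ? sub ?]; split=> //.
  by rewrite disjoints_subset setCK.
Qed.

(** Dropping a minimal member [C] keeps the family upward closed, so by minimality
    of the family some partial decomposition leaves [C] as its only component in
    the family.  Gluing two such decompositions avoids the family. *)
Lemma minimal_blocking_touch B :
    blocking B -> (forall B', blocking B' -> B' \subset B -> B' = B) ->
  forall C D, C \in B -> D \in B -> touch C D.
Proof.
move=> [Bf Bup Bhit] minB C0 D0 C0B D0B; apply: contrapT => ntouch0.
have below E : E \in B -> exists C, [/\ C \in B, C \subset E &
    forall C', C' \in B -> C' \subset C -> C' = C].
  move=> EB; have [C /minsetP[CB minC] CE] := @minset_exists _ (mem B) E EB.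
  by exists C; split.
have only C : C \in B -> (forall C', C' \in B -> C' \subset C -> C' = C) ->
  exists T bag U, [/\ @partial_decomposition G m T bag U, is_component U C &
    forall E, E \in B -> is_component U E -> E = C].
  move=> CB minC; apply: contrapT => none.
  have bl : blocking (B :\ C).
    split=> [E /setD1P[_ /Bf] //|E E' /setD1P[EC EB] fE' EE'|T bag U pd].
      apply/setD1P; split; last exact: Bup EE'.
      by apply: contraNneq EC => E'C; apply/eqP; apply: minC; rewrite // -E'C.
    apply: contrapT => noE; apply: none; exists T, bag, U.
    have onlyC E : E \in B -> is_component U E -> E = C.
      move=> EB cE; apply/eqP/negPn/negP => EC; apply: noE; exists E => //.
      by rewrite !inE EC.
    have [E EB cE] := Bhit T bag U pd.
    by split=> //; rewrite -(onlyC E EB cE).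
  have := minB _ bl (subD1set _ _) => /setP/(_ C).
  by rewrite !inE eqxx CB.
have [C [CB CC0 minC]] := below C0 C0B; have [D [DB DD0 minD]] := below D0 D0B.
have ntouch : ~ touch C D by move=> t; apply: ntouch0; exact: touchS CC0 DD0 t.
have [T1 [bag1 [U1 [pd1 cC onlyC]]]] := only C CB minC.
have [T2 [bag2 [U2 [pd2 cD onlyD]]]] := only D DB minD.
have [S [P [Q [phi1 [phi2 [[cover dSP dSQ dPQ] noPQ [CP DQ] [p1 d1] [p2 d2]]]]]]] :=
  linked_separation ntouch.
have [T [bag [U [pd comps]]]] := glue_partial_decompositions pd1 cC pd2 cD cover
  dSP dSQ dPQ noPQ CP DQ p1 d1 p2 d2.
have [E EB cE] := Bhit T bag U pd.
have [E' EE' [[cE' ne]|[cE' ne]]] := comps E cE.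
  by apply: ne; apply: onlyC => //; apply: Bup EE' => //; exact: component_flap pd1 cE'.
by apply: ne; apply: onlyD => //; apply: Bup EE' => //; exact: component_flap pd2 cE'.
Qed.

Definition bramble (B : {set {set G}}) :=
  (forall b, b \in B -> connected_set b) /\
  (forall b b', b \in B -> b' \in B -> touch b b').

(** A minimal blocking family is the bramble.  A set [X] of [m] vertices misses
    one of its members because the single bag [X] is a partial decomposition,
    which leaves a component in the family. *)
Theorem treewidth_bramble : 0 < m -> m <= treewidth G ->
  exists2 B, bramble B &
    forall X, #|X| <= m -> exists2 b, b \in B & [disjoint b & X].
Proof.
move=> m_gt0 tw.
have proper T bag U : @partial_decomposition G m T bag U -> exists x, x \notin U.
  move=> pd; apply: contrapT => all.
  have inU x : x \in U by apply/negPn/negP => xU; apply: all; exists x.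
  have : treewidth G <= width bag.
    rewrite /treewidth; case: ex_minnP => w _; apply; apply/asboolP.
    exists T, bag; split=> //; split.
    - exact: bridge_tree_is_tree (pd_tree pd).
    - by move=> x y xy; exact: (pd_edge pd (inU x) (inU y) xy).
    - by move=> x; exact: (pd_conn pd (inU x)).
  rewrite leqNgt => /negP; apply; apply: leq_trans tw.
  rewrite /width -(ltn_predK m_gt0) ltnS -!subn1 leq_sub2r //.
  by apply/bigmax_leqP => t _; exact: (pd_size pd).
have bl0 : blocking [set E | `[< flap E >]].
  split=> [E|E E' _ fE' _|T bag U pd].
  - by rewrite inE => /asboolP.
  - by rewrite inE; apply/asboolP.
  - have [x xU] := proper T bag U pd.
    have cE := component_is_component xU; exists (component U x) => //.
    by rewrite inE; apply/asboolP; exact: component_flap pd cE.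
have /asboolP bl0' := bl0.
have [B /minsetP[/asboolP blB minB] _] :=
  @minset_exists _ (fun B => `[< blocking B >]) _ bl0'.
exists B.
  split; first by case: blB => Bf _ _ b /Bf[].
  apply: minimal_blocking_touch => // B' /asboolP bl'; exact: minB.
move=> X X_le.
have pd : @partial_decomposition G m unit_graph (fun=> X) X.
  split=> //.
  - exact: bridge_tree_unit.
  - move=> x xX; have -> : [set t : unit_graph | x \in X] = [set tt].
      by apply/setP => -[]; rewrite !inE xX.
    exact: connected1.
  - by move=> x y xX yX _; exists tt; rewrite xX.
  - by move=> E [_ _ nE]; exists tt.
by have [_ _ /(_ _ _ _ pd) [b bB [_ dX _]]] := blB; exists b.
Qed.

End Duality.

(** * Wheels from marked cycles *)

Section Wheel.
Variable G : sgraph.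
Implicit Types (A B C D H X : {set G}) (c q s : seq G) (u v w x y : G).

Lemma connected_path x s : path (@edge G) x s -> connected_set [set z in x :: s].
Proof.
move=> xs; apply: (@connectedI _ x); first by rewrite inE mem_head.
move=> K xK cl y; rewrite inE.
have : {subset x :: s <= [set z in x :: s]} by move=> z zs; rewrite in_set.
move: [set z in x :: s] cl => A; elim: s x xs xK => [|z s IHs] x /=.
  by move=> _ xK _ _; rewrite inE => /eqP->.
move=> /andP[xz zs] xK cl sub; rewrite inE => /orP[/eqP->//|].
have zA : z \in A by apply: sub; rewrite !inE eqxx orbT.
apply: (IHs z zs) => //; first by apply: (cl x) => //; apply: sub; exact: mem_head.
by move=> t ts; apply: sub; rewrite inE ts orbT.
Qed.

(** The cycle is read from a marked vertex and cut before every further mark,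
    up to [n - 1] times.  So position [p] belongs to the arc whose number is the
    count of marks among the positions 1 to [p], truncated at [n - 1]. *)
Lemma wheel_of_marked_cycle n c H :
    0 < n -> ucycle (@edge G) c -> connected_set H ->
    (forall x, x \in c -> x \notin H) ->
    n <= #|[set x in c | x \in nbhd H]| ->
  minor (add_apex (cycle_graph n)) G.
Proof.
move=> n_gt0 cyc cH cNH marks; pose a := [pred x | x \in nbhd H].
have {marks} le_n : n <= count a c.
  apply: leq_trans marks _; rewrite -size_filter; apply: leq_trans (card_size _).
  by apply: subset_leq_card; apply/subsetP => x; rewrite inE mem_filter andbC.
have /hasP[x xc ax] : has a c by rewrite has_count (leq_trans n_gt0).
have [i s ci] := rot_to xc.
have {}cyc : ucycle (@edge G) (x :: s) by rewrite -ci rot_ucycle.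
have {}le_n : n.-1 <= count a s.
  have := seq.permP (permEl (perm_rot i c)) a; have /= axE := ax.
  rewrite ci /= axE => cnt.
  by rewrite -cnt in le_n; case: (n) le_n.
have {xc ci i} cNH y : y \in x :: s -> y \notin H.
  by rewrite -ci mem_rot; exact: cNH.
have [/= cpath] := andP cyc; set us := _ && _ => /= uxs.
have {us uxs} uxs : uniq (x :: s) by [].
pose f p := minn n.-1 (count a (take p s)).
pose w p := nth x (x :: s) p.
have winj p p' : p <= size s -> p' <= size s -> w p = w p' -> p = p'.
  by move=> lp lp' /eqP; rewrite nth_uniq // => /eqP.
have wmem p : p <= size s -> w p \in x :: s by move=> lp; exact: mem_nth.
have wstep p : p < size s -> edge (w p) (w p.+1).
  move=> lp; have /(pathP x)/(_ p) := cpath.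
  by rewrite size_rcons ltnS (ltnW lp) -rcons_cons !nth_rcons /= ltnS (ltnW lp) lp; apply.
have wlast : edge (w (size s)) (w 0).
  have /(pathP x)/(_ (size s)) := cpath.
  by rewrite size_rcons ltnS leqnn -rcons_cons !nth_rcons /= ltnn ltnSn eqxx; apply.
have f0 : f 0 = 0 by rewrite /f take0 /= minn0.
have flast : f (size s) = n.-1.
  by rewrite /f take_size; apply/minn_idPl.
have fS p : p < size s -> f p <= f p.+1 <= (f p).+1 /\ (f p < f p.+1 -> a (w p.+1)).
  move=> lp; rewrite /f (take_nth x lp) -cats1 count_cat /= addn0.
  rewrite /w /=; case: (_ \in nbhd H); split=> //; lia.
have fle p p' : p <= p' -> p' <= size s -> f p <= f p'.
  elim: p' => [|p' IHp]; first by rewrite leqn0 => /eqP->.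
  rewrite leq_eqVlt => /orP[/eqP->//|lp] lp'.
  apply: leq_trans (IHp lp (ltnW lp')) _.
  by have [/andP[le_f _] _] := fS p' lp'.
(* an arc starts at the first position with its number, which is marked *)
have first i : i < n -> exists p, [/\ p <= size s, f p = i, forall p', f p' = i -> p <= p',
    a (w p) & 0 < i -> 0 < p /\ f p.-1 = i.-1].
  move=> lt_in.
  have ex : exists p, i <= f p by exists (size s); rewrite flast; case: (n) lt_in.
  case: (ex_minnP ex) => p ip minp.
  have lps : p <= size s.
    by apply: minp; rewrite flast; case: (n) lt_in.
  exists p; case: p ip minp lps => [|p] ip minp lps.
    rewrite f0 in ip *; move: ip; rewrite leqn0 => /eqP->.
    by split=> //.
  have lt_fp : f p < i by rewrite ltnNge; apply/negP => /minp; rewrite ltnn.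
  have [/andP[_ le_f] mark] := fS p lps.
  have fp : f p.+1 = i by apply/eqP; rewrite eqn_leq ip (leq_trans le_f).
  split=> //.
  - by move=> p' fp'; apply: minp; rewrite fp'.
  - by apply: mark; rewrite fp.
  - move=> _; split=> //=; apply/eqP; rewrite -eqSS eqn_leq.
    by rewrite (ltn_predK lt_fp) lt_fp -fp le_f.
pose arc (i : nat) := [set w p | p : 'I_(size s).+1 & f p == i].
have arcP i y : reflect (exists p, [/\ p <= size s, f p = i & y = w p]) (y \in arc i).
  apply: (iffP imsetP) => [[p]|[p [lp fp ->]]].
    by rewrite inE => /eqP fp ->; exists p; rewrite -ltnS ltn_ord.
  by exists (Ordinal (lp : p < (size s).+1)); rewrite ?inE ?fp.
have arc_conn (i : 'I_n) : connected_set (arc i).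
  have [p0 [lp0 fp0 minp0 _ _]] := first i (ltn_ord i).
  apply: (@connectedI _ (w p0)); first by apply/arcP; exists p0.
  move=> K p0K cl _ /arcP[p [lp fp ->]]; have := minp0 p fp.
  elim: p lp fp => [|p IHp] lp fp; first by rewrite leqn0 => /eqP p00; rewrite p00 in p0K.
  rewrite leq_eqVlt => /orP[/eqP<-//|lt_p].
  have fp' : f p = i.
    by apply/eqP; rewrite eqn_leq -{1}fp fle //= -fp0 fle // ltnW.
  apply: (cl (w p)) (IHp (ltnW lp) fp' lt_p); last exact: wstep.
    by apply/arcP; exists p; rewrite ltnW.
  by apply/arcP; exists p.+1.
have arc_next (i j : 'I_n) : i != j -> j = ordS i ->
    exists u v, [/\ u \in arc i, v \in arc j & edge u v].
  move=> ij jS; have jE : j = i.+1 %% n :> nat by rewrite jS.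
  have [lt_in|] := ltnP i.+1 n.
    rewrite modn_small // in jE.
    have [p [lp fp _ _ []]] := first j (ltn_ord j); first by rewrite jE.
    case: p lp fp => // p lp fp _ /= fp'; exists (w p), (w p.+1); split.
    - by apply/arcP; exists p; rewrite ltnW // fp' jE.
    - by apply/arcP; exists p.+1.
    - exact: wstep.
  move=> le_ni; have ni : i.+1 = n by apply/eqP; rewrite eqn_leq le_ni ltn_ord.
  rewrite ni modnn in jE; exists (w (size s)), (w 0); split=> //.
  - by apply/arcP; exists (size s); split; rewrite // flast; lia.
  - by apply/arcP; exists 0; rewrite f0 jE.
pose phi (o : add_apex (cycle_graph n)) : {set G} :=
  if o is Some i then arc (i : 'I_n) else H.
have hub i : i < n -> exists u v, [/\ u \in H, v \in arc i & edge u v].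
  move=> /first[p [lp fp _ /nbhdP[_ [u uH uw]] _]].
  by exists u, (w p); split=> //; apply/arcP; exists p.
have arcH i y : y \in arc i -> y \notin H.
  by move=> /arcP[p [lp _ ->]]; apply: cNH; exact: wmem.
exists phi; split.
- by case=> [i|] //=; exact: arc_conn.
- move=> [i|] [j|] //= ij; apply/disjointP => y; last 2 first.
  + exact: arcH.
  + by apply: contraL; exact: arcH.
  move=> /arcP[p [lp fp ->]]; apply/negP => /arcP[p' [lp' fp' /winj]].
  move=> /(_ lp lp') pp'; case/negP: ij; apply/eqP; congr Some.
  by apply: val_inj; rewrite /= -fp -fp' pp'.
- move=> [i|] [j|] //=.
  + case/andP => ij /orP[/eqP|/eqP]; first exact: arc_next.
    rewrite eq_sym in ij => /(arc_next _ _ ij)[u [v [uj vi uv]]].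
    by exists v, u; rewrite edge_sym.
  + by move=> _; have [u [v [? ? ?]]] := hub i (ltn_ord i); exists v, u; rewrite edge_sym.
  + by move=> _; exact: hub (ltn_ord j).
Qed.

Lemma ucycle_chord v q d :
    path (@edge G) v q -> uniq (v :: q) -> path (@edge G) v d -> uniq (v :: d) ->
    (forall z, z \in d -> z \notin q) -> edge (last v d) (last v q) ->
  ucycle (@edge G) (v :: (q ++ rev d)).
Proof.
rewrite !cons_uniq => pq /andP[vq uq] pd /andP[vd ud] dq chord.
apply/andP; split.
  rewrite /= rcons_cat cat_path pq /= -rev_cons lastI rev_rcons /=.
  rewrite edge_sym chord /= rev_path.
  by apply: sub_path pd => u w; rewrite edge_sym.
rewrite cons_uniq mem_cat mem_rev negb_or vq vd cat_uniq rev_uniq uq ud !andbT /=.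
by apply/hasPn => z; rewrite mem_rev; exact: dq.
Qed.

Lemma connected_simple_path D v y : connected_set D -> v \in D -> y \in D ->
  exists d, [/\ path (@edge G) v d, uniq (v :: d), {subset v :: d <= D}
    & last v d = y].
Proof.
move=> cD vD yD; have /connectP[d0 pd0 ->] := cD.2 v y vD yD.
case/shortenP: pd0 => d pd ud _; exists d; split=> //.
  by apply: sub_path pd => u w /andP[].
move=> z; rewrite inE => /orP[/eqP->//|zd].
have : all (mem D) d; last by move/allP => /(_ z zd).
by move: pd; elim: (d) (v) => //= u d1 IHd v1 /andP[/andP[/andP[_ ->] _] /IHd].
Qed.

(** * Wheels from brambles *)

Section BrambleWheel.
Variable B : {set {set G}}.
Hypothesis brB : bramble B.

(** The path is listed from its last vertex [v] backwards.  The component [D] is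
    one of the complement of [q]: the last step of the path goes into it. *)
Definition hitting_path v q D :=
  [/\ uniq (v :: q) /\ path (@edge G) v q,
    connected_set D /\ v \in D, forall x, x \in q -> x \notin D,
    nbhd D \subset [set x in q] /\ (exists2 b, b \in B & b \subset D)
  & forall b, b \in B -> exists2 x, x \in b & x \in v :: q].

(** The members that a path misses touch each other, so they all lie in one
    component [D'] of its complement.  The last vertex has a neighbour in [D']
    because it belongs to [D], which is connected and contains [D']; moving to
    that neighbour replaces [D] by [D'], which is smaller. *)
Lemma growing_path b0 : b0 \in B ->
  exists v q D, hitting_path v q D.
Proof.
have [cB tB] := brB; move=> b0B.
have grow n : forall v q D, #|D| <= n ->
    uniq (v :: q) /\ path (@edge G) v q -> is_component [set x in q] D -> v \in D ->
    (forall b, b \in B -> (forall x, x \in b -> x \notin q) -> b \subset D) ->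
    (exists2 b, b \in B & b \subset D) ->
  exists v q D, hitting_path v q D.
  elim: n => [|n IHn] v q D leD [uq pq] [cD dD nD] vD inD exb.
    by move: leD; rewrite leqn0 cards_eq0 => /eqP D0; rewrite D0 inE in vD.
  have qD x : x \in q -> x \notin D.
    by move=> xq; apply/negP => /(disjointP dD); rewrite inE xq.
  have [all|] := pselect (forall b, b \in B -> exists2 x, x \in b & x \in v :: q).
    by exists v, q, D; split.
  move=> /asboolPn/existsp_asboolPn[b /asboolPn/imply_asboolPn[bB nb]].
  have bq x : x \in b -> x \notin v :: q.
    by move=> xb; apply/negP => xq; apply: nb; exists x.
  have [/set0Pn[x xb] _] := cB b bB.
  pose U := [set x in v :: q]; pose D' := component U x.
  have xU : x \notin U by rewrite inE bq.
  have cD' : is_component U D' := component_is_component xU.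
  have [coD' dD' nD'] := cD'.
  have sub b' : b' \in B -> (forall z, z \in b' -> z \notin v :: q) -> b' \subset D'.
    move=> b'B b'q; have sb : b :|: b' \subset D'.
      apply: (sub_component cD' _ _ _ (mem_component _ _)).
      - by apply: connectedU; [exact: cB | exact: cB | exact: tB].
      - by apply/disjointP => z; rewrite !inE => /orP[/bq|/b'q]; rewrite inE.
      - by rewrite inE xb.
    exact: subset_trans (subsetUr _ _) sb.
  have xD : x \in D.
    apply: (subsetP (inD b bB _)) xb => z /bq; rewrite inE negb_or => /andP[_ //].
  have D'D : D' \subset D.
    have cDq : is_component [set x in q] D by split.
    have xD' : x \in D' by exact: mem_component.
    apply: (sub_component cDq coD' _ xD' xD).
    by apply: disjointWr dD'; apply/subsetP => z; rewrite !inE => ->; rewrite orbT.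
  have vD' : v \notin D' by apply/negP => /(disjointP dD'); rewrite !inE eqxx.
  have [v' v'D v'v] : exists2 v', v' \in D' & edge v' v.
    have [z zD zn] := connected_exit cD xD (mem_component U x) vD vD'.
    have [_ [u uD' uz]] := nbhdP zn.
    have := subsetP nD' _ zn; rewrite !inE => /orP[/eqP zv|zq].
      by exists u; rewrite // -zv.
    by have := qD z zq; rewrite zD.
  apply: (IHn v' (v :: q) D') => //.
  - rewrite -ltnS; apply: leq_trans leD; apply: proper_card.
    by apply/properP; split=> //; exists v.
  - by split; rewrite /= ?v'v // -/(uniq (v :: q)) uq andbT; have := disjointP dD' v' v'D; rewrite inE.
  - by exists b => //; exact: sub.
have [/set0Pn[x xb0] _] := cB b0 b0B.
have xN : x \notin [set x : G in [::]] by rewrite inE.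
have cD := component_is_component xN.
have sub b : b \in B -> b \subset component [set x : G in [::]] x.
  move=> bB; apply: subset_trans (subsetUr b0 b) _.
  apply: (sub_component cD _ _ _ (mem_component _ _)); last by rewrite inE xb0.
    by apply: connectedU; [exact: cB | exact: cB | exact: tB].
  by apply/disjointP => z _; rewrite inE.
apply: (grow _ x [::] _ (leqnn _) _ cD) => //.
- exact: mem_component.
- by move=> b bB _; exact: sub.
- by exists b0 => //; exact: sub.
Qed.

(** The subfamily of the members that meet [Y] has order at most [m]. *)
Definition covered m (Y : seq G) := exists2 X : {set G}, #|X| <= m &
  forall b x, b \in B -> x \in b -> x \in Y -> ~~ [disjoint b & X].

Lemma covered_nil m : covered m [::].
Proof. by exists set0; rewrite ?cards0. Qed.

Lemma covered_cons m v Y : covered m Y -> covered m.+1 (v :: Y).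
Proof.
move=> [X leX hit]; exists (v |: X).
  by rewrite cardsU1 -add1n; apply: leq_add leX; case: (_ \notin _).
move=> b x bB xb; rewrite inE => /orP[/eqP xv|/(hit b x bB xb)].
  by apply/negP => /disjointP/(_ x xb); rewrite xv setU11.
by apply: contra; apply: disjointWr; exact: subsetUr.
Qed.

Lemma uncovered m Y X : ~ covered m Y -> #|X| <= m ->
  exists b x, [/\ b \in B, x \in b, x \in Y & [disjoint b & X]].
Proof.
move=> nc leX; apply: contrapT => none; apply: nc; exists X => // b x bB xb xY.
by apply/negP => d; apply: none; exists b, x.
Qed.

Lemma exists_threshold (P : nat -> Prop) N :
  P 0 -> ~ P N -> exists i, P i /\ ~ P i.+1.
Proof.
move=> P0; elim: N => [|N IHN] // nPS.
by have [PN|/IHN] := pselect (P N); [exists N | apply].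
Qed.

(** With [p] listed backwards, the parts called [A] and [S] above are [drop j p]
    and [take i p]. *)
Lemma bramble_wheel n : 2 < n ->
    (forall X, #|X| <= n + n.-1 -> exists2 b, b \in B & [disjoint b & X]) ->
  minor (wheel n.+1) G.
Proof.
move=> n_gt2 order; have [cB tB] := brB.
have [b0 b0B _] : exists2 b, b \in B & [disjoint b & set0 : {set G}].
  by apply: order; rewrite cards0.
have [v [q [D [[up pp] [cD vD] qD [nD [b bB bD]] hitp]]]] := growing_path b0B.
pose p := v :: q.
have ncp : ~ covered n.-1 p.
  move=> [X leX hit]; have [|b1 b1B d1] := order X.
    by apply: leq_trans leX (leq_addl _ _).
  by have [x xb xp] := hitp b1 b1B; have := hit b1 x b1B xb xp; rewrite d1.
have [i [covS ncS]] : exists i, covered n.-1 (take i p) /\ ~ covered n.-1 (take i.+1 p).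
  apply: (@exists_threshold (fun i => covered n.-1 (take i p)) (size p)).
    by rewrite take0; exact: covered_nil.
  by rewrite take_size.
have [j [covA ncA]] : exists j, covered n (drop j p) /\ ~ covered n.-1 (drop j p).
  have [|c_drop|j [ncj /contrapT cj]] :=
    @exists_threshold (fun j => ~ covered n.-1 (drop j p)) (size p).
  - by rewrite drop0.
  - by apply: c_drop; rewrite drop_size; exact: covered_nil.
  exists j; split=> //; have [lt_j|] := ltnP j (size p).
    by rewrite (drop_nth v lt_j) -(ltn_predK n_gt2); exact: covered_cons.
  by move=> le_j; case: ncj; rewrite drop_oversize //; exact: covered_nil.
have [X1 leX1 hitA] := covA; have [X2 leX2 hitS] := covS.
have [|b' b'B d'] := order (X1 :|: X2).
  by apply: leq_trans (leq_card_setU _ _) (leq_add leX1 leX2).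
have b'A x : x \in b' -> x \notin drop j p.
  move=> xb; apply/negP => /(hitA b' x b'B xb); rewrite (disjointWr _ d') //.
  exact: subsetUl.
have b'S x : x \in b' -> x \notin take i p.
  move=> xb; apply/negP => /(hitS b' x b'B xb); rewrite (disjointWr _ d') //.
  exact: subsetUr.
(* b' avoids drop j p and take i p, so a neighbour of D in b' is between them *)
have [x [y [xb' xq yD yx]]] : exists x y, [/\ x \in b', x \in q, y \in D & edge y x].
  have [z zb' zp] := hitp b' b'B.
  (* z is not v: a single vertex is covered by itself, so v is in take i p *)
  have zq : z \in q.
    move: zp; rewrite inE => /orP[/eqP zv|//].
    have i_gt0 : 0 < i.
      rewrite lt0n; apply/eqP => i0; apply: ncS; rewrite i0 /= take0.
      rewrite -(ltn_predK (_ : 1 < n.-1)); last by case: (n) n_gt2 => [|[|[|?]]].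
      by apply: covered_cons; exact: covered_nil.
    by have := b'S z zb'; rewrite zv -(ltn_predK i_gt0) /= mem_head.
  have [/set0Pn[t tb] _] := cB b bB.
  have cbb : connected_set (b :|: b') by apply: connectedU; auto.
  have [x xbb xn] : exists2 x, x \in b :|: b' & x \in nbhd D.
    apply: (connected_exit (x := t) (y := z) cbb); rewrite ?inE ?tb ?zb' ?orbT //.
      exact: (subsetP bD).
    exact: qD.
  have xq : x \in q by have := subsetP nD x xn; rewrite inE.
  have [_ [y yD yx]] := nbhdP xn; exists x, y; split=> //.
  move: xbb; rewrite inE => /orP[xb|//].
  by have := qD x xq; rewrite (subsetP bD).
pose r := index x q.
have lt_rq : r < size q by rewrite index_mem.
have nth_r : nth v q r = x by exact: nth_index.
have [vq uq] : v \notin q /\ uniq q by apply/andP.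
have xp : x \in p by rewrite inE xq orbT.
have index_x : index x p = r.+1.
  by rewrite /p /=; case: eqP => [vx|//]; rewrite vx xq in vq.
have le_ir : i <= r.+1.
  by have := b'S x xb'; rewrite in_take // index_x -leqNgt.
have lt_rj : r.+1 < j.
  rewrite ltnNge; apply/negP => le_jr; case/negP: (b'A x xb').
  rewrite -(nth_index v xp) index_x -(subnKC le_jr) -nth_drop mem_nth //.
  by rewrite size_drop ltn_sub2r //; apply: leq_ltn_trans le_jr _.
pose q1 := take r.+1 q.
have pE : take r.+2 p = v :: q1 by [].
have q1x : last v q1 = x.
  by rewrite /q1 (take_nth v lt_rq) last_rcons.
have [d [pd ud dD dy]] := connected_simple_path cD vD yD.
pose c := v :: (q1 ++ rev d).
have q1q : {subset q1 <= q} by exact: mem_take.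
have dq z : z \in d -> z \notin q.
  move=> zd; have zD : z \in D by apply: dD; rewrite inE zd orbT.
  by apply/negP => /qD; rewrite zD.
have cyc : ucycle (@edge G) c.
  apply: ucycle_chord => //.
  - exact: take_path.
  - by rewrite /= take_uniq // andbT; apply: contra vq; exact: q1q.
  - by move=> z /dq; apply: contra; exact: q1q.
  - by rewrite dy q1x.
have uA z : z \in drop j p -> z \notin c.
  move=> zA; have zp : z \in p by exact: mem_drop zA.
  have zN : z \notin take r.+2 p.
    have : uniq (take j p ++ drop j p) by rewrite cat_take_drop.
    rewrite cat_uniq => /and3P[_ /hasPn/(_ z zA) zt _]; apply: contra zt.
    by rewrite -(subnKC lt_rj) takeD mem_cat => ->.
  rewrite pE inE negb_or in zN; case/andP: zN => zv zq1.
  rewrite /c inE mem_cat mem_rev !negb_or zv zq1 /=.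
  by apply/negP => /dq; move: zp; rewrite inE (negPf zv) /= => ->.
have cA : connected_set [set z in drop j p].
  have : sorted (@edge G) (drop j p) by exact: drop_sorted.
  case: (drop j p) ncA => [|z0 s0] nc /=; last exact: connected_path.
  by case: nc; exact: covered_nil.
have [/set0Pn[a]] := cA; rewrite inE => aA _.
pose Cset := [set z in c]; pose H := component Cset a.
have cH : is_component Cset H by apply: component_is_component; rewrite inE uA.
have AH : {subset drop j p <= H}.
  move=> z zA; apply: (subsetP (sub_component cH cA _ _ (mem_component _ a))); rewrite ?inE //.
  by apply/disjointP => t; rewrite !inE; exact: uA.
have [coH dH nH] := cH.
apply: (@wheel_of_marked_cycle n c H) => //.
- by case: (n) n_gt2.
- by move=> z zc; apply/negP => /(disjointP dH); rewrite inE zc.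
have -> : [set z in c | z \in nbhd H] = nbhd H.
  apply/setP => z; rewrite inE; apply: andb_idl => /(subsetP nH).
  by rewrite inE.
rewrite leqNgt; apply/negP => lt_n.
have le_n : #|nbhd H| <= n.-1 by rewrite -ltnS (ltn_predK n_gt2).
have [b1 [x1 [b1B x1b x1A d1]]] := uncovered ncA le_n.
have [b2 [x2 [b2B x2b x2S d2]]] := uncovered ncS le_n.
have x2c : x2 \in c.
  have : x2 \in take r.+2 p.
    by rewrite -(subnKC (_ : i.+1 <= r.+2)) // takeD mem_cat x2S.
  by rewrite pE !inE mem_cat => /orP[->//|->]; rewrite orbT.
have [z] : exists2 z, z \in b1 :|: b2 & z \in nbhd H.
  apply: (connected_exit (x := x1) (y := x2)).
  - by apply: connectedU; auto.
  - by rewrite inE x1b.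
  - exact: AH.
  - by rewrite inE x2b orbT.
  - by apply/negP => /(disjointP dH); rewrite inE x2c.
by rewrite inE => /orP[/(disjointP d1)/negPf->|/(disjointP d2)/negPf->].
Qed.

End BrambleWheel.
End Wheel.

(** * Treewidth of graphs without a wheel minor *)

Lemma treewidth_no_wheel k (G : sgraph) :
  3 < k -> ~ minor (wheel k) G -> treewidth G < k.-1 + k.-2.
Proof.
move=> k_gt3 noW; rewrite ltnNge; apply/negP => tw; apply: noW.
have m_gt0 : 0 < k.-1 + k.-2 by lia.
have [B brB order] := treewidth_bramble m_gt0 tw.
by rewrite -(ltn_predK k_gt3); apply: (bramble_wheel brB) order; lia.
Qed.

Import Order.TTheory GRing.Theory Num.Theory.

Local Open Scope ring_scope.

Theorem corollary1p6 (R : realType) (k : nat) (hk : (4 <= k)%N)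
    (G : sgraph) (hG : ~ minor (wheel k) G) :
  (treewidth G)%:Z <=
    2 * k%:Z + 18 * Num.ceil ((1 + Num.sqrt (2 * k%:R - 1)) / 4 : R) - 10.
Proof.
have tw := treewidth_no_wheel hk hG.
have : (0 < Num.ceil ((1 + Num.sqrt (2 * k%:R - 1)) / 4 : R)).
  rewrite ceil_gt0 divr_gt0 // ltr_pwDl ?ltr01 ?sqrtr_ge0 //.
lia.
Qed.
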